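(* Let $G^s:H$ be the graph resulting from a safe split-and-glue of a safe base graph $G$ and a safe ear $H$. If $G^s:H$ is independent, then $G^s:H$ has some implied nonedge.
   Context: All graphs are finite and simple. Rank, independence and circuits refer to the 3-dimensional generic rigidity matroid $\mathcal{R}_3$; $\mathrm{rank}(G)$ is the rank of $E(G)$, $G$ is independent if $\mathrm{rank}(G)=|E(G)|$. A nonedge $f$ of $G$ is implied if $G\cup f$ contains a circuit containing $f$. For a set $F$ of vertex pairs, $G_F=G\cup F$ is $G$ with the pairs of $F$ having both endpoints in $V(G)$ added as edges; $G_F[X]$ is its induced subgraph on $X$. 2-thin covers: a 2-thin cover of $G$ is a collection $\mathcal X=\{X_1,\dots,X_k\}$ of subsets (clusters) of $V(G)$ with $|X_i|\ge 2$, $|X_i\cap X_j|\le 2$ and $X_i\not\subset X_j$ for $i\ne j$, such that both endpoints of each edge lie in some cluster. Its shared set $S(\mathcal X)$ is the set of pairs $\{u,v\}$ equal to $X_i\cap X_j$ for some $i\ne j$; $\mathcal X$ is independent if the graph formed by the pairs of $S(\mathcal X)$ is independent. $d(\mathcal X,e)$ is the number of clusters containing both endpoints of $e$. For a set $K$ of pairs, $IE_K(G,\mathcal X)=\sum_i\mathrm{rank}(G_{S(\mathcal X)\cup K}[X_i])-\sum_{e\in S(\mathcal X)\cup K}(d(\mathcal X,e)-1)$, and $IE(G,\mathcal X)=IE_\emptyset(G,\mathcal X)$. Nonedge-split of a nonedge $(a,b)$: add new vertices $a_1,a_2$ whose neighbourhoods partition $N(a)$, new vertices $b_1,b_2$ whose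 neighbourhoods partition $N(b)$, delete $a,b$; result $G^s$. A safe nonedge-split on $(G,\mathcal X)$ ($\mathcal X$ a 2-thin cover of $G$) is a nonedge-split of a nonedge $(a,b)$ with $\{a,b\}\in S(\mathcal X)$ such that, with $X_i'=(X_i\setminus\{a,b\})\cup W_i$ where $W_i$ is the set of vertices of $\{a_1,a_2,b_1,b_2\}$ adjacent in $G^s$ to some vertex of $X_i$: (S1) whenever $X_i$ contains both endpoints of some pair of $S(\mathcal X)$ that is a nonedge of $G$, neither $\{a_1,a_2\}$ nor $\{b_1,b_2\}$ is a subset of $X_i'$; (S2) if $X_i\cap X_j=\{a,u\}$ with $u\ne b$ and $(a,u)$ a nonedge of $G$, then $X_i'\cap\{a_1,a_2\}=X_j'\cap\{a_1,a_2\}$, and symmetrically with $a,a_1,a_2$ replaced by $b,b_1,b_2$. The safe split cover $\mathcal X^s$ of $G^s$ consists of those $X_i'$ of size greater than two containing neither $\{a_1,a_2\}$ nor $\{b_1,b_2\}$, together with the endpoint pairs $\{x,y\}$ of the edges of $G^s$ not contained in any of these sets. A key gluing pair of $G^s$ is a pair of distinct vertices of $\{a_1,a_2,b_1,b_2\}$ contained in some cluster of $\mathcal X^s$; the gluing vertices of $G^s$ are a chosen subset of $\{a_1,a_2,b_1,b_2\}$ containing all endpoints of key gluing pairs. A safe base graph is an independent graph $G$ with an independent 2-thin cover $\mathcal X$ such that $\mathrm{rank}(G)=IE(G,\mathcal X)$ and $S(\mathcal X)$ contains a nonedge $(a,b)$ of $G$ that can be split by a safe nonedge-split on $(G,\mathcal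 X)$. A safe ear is a graph $H$ with an independent 2-thin cover $\mathcal X^H$ (safe ear cover) and a set of gluing vertices such that, calling a key gluing pair of $H$ any pair of distinct gluing vertices contained in a common cluster of $\mathcal X^H$ and $K_H$ the set of these: (E1) each cluster of $\mathcal X^H$ contains at most two gluing vertices; (E2) $S(\mathcal X^H)\cup F$ is independent, where $F$ is the set of all pairs of distinct gluing vertices; (E3) $\mathrm{rank}(H)=IE_{K_H}(H,\mathcal X^H)-1$. A safe split-and-glue of a safe base graph $G$ (with $\mathcal X$, $(a,b)$) and a vertex-disjoint safe ear $H$: perform a safe nonedge-split on $(G,\mathcal X)$ yielding $G^s$, then form $G^s:H$ by bijectively identifying the gluing vertices of $G^s$ with the gluing vertices of $H$ so that the key gluing pairs of $G^s$ correspond bijectively to the key gluing pairs of $H$. *)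

(* Defs.v *)
From HB Require Import structures.
From mathcomp Require Import all_boot all_order all_algebra.
From mathcomp Require Import mpoly.

Set Implicit Arguments.
Unset Strict Implicit.
Unset Printing Implicit Defensive.

Import GRing.Theory Num.Theory.
Local Open Scope ring_scope.

(* MathComp. All graphs live in an ambient finite type U of potential vertices:
   a graph has a vertex set in U and a set of edges, an edge being a
   two-element vertex set.  Vertex-disjointness and "new vertices" then have
   their literal meaning, and all edge sets lie in one matroid, the generic
   rigidity matroid of the complete graph on U. *)

Section Rigidity.
Variable U : finType.

(* Q(x_{v,i} : v in U, i < 3): the coordinates of the generic placement are
   indeterminates, hence algebraically independent over Q. *)
Definition coord_field := {fraction {mpoly rat[#|{: U * 'I_3}|]}}.

Definition generic_coord (v : U) (i : 'I_3) : coord_field :=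
  tofrac ('X_(enum_rank (v, i)) : {mpoly rat[#|{: U * 'I_3}|]}).

(* For e = {u, v}, the row with p(u) - p(v) in the columns of u, p(v) - p(u)
   in those of v, and 0 elsewhere (the term w = v of the sum vanishes). *)
Definition rigidity_row (e : {set U}) : 'rV[coord_field]_(#|{: U * 'I_3}|) :=
  \row_k (let: (v, i) := enum_val k in
          if v \in e then \sum_(w in e) (generic_coord v i - generic_coord w i)
          else 0).

Definition rigidity_mx (F : {set {set U}}) :=
  \matrix_(k < #|F|) rigidity_row (enum_val k).

Definition rk (F : {set {set U}}) : nat := \rank (rigidity_mx F).

Definition indep (F : {set {set U}}) : bool := rk F == #|F|.

Definition circuit (C : {set {set U}}) : bool :=
  minset (fun D => ~~ indep D) C.

Record graph := Graph {
  verts : {set U};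
  edges : {set {set U}};
  _ : [forall e in edges, (#|e| == 2) && (e \subset verts)]
}.

Implicit Types (G H : graph) (F K : {set {set U}}) (A B W : {set U}).

Definition nonedge G (f : {set U}) : bool :=
  [&& #|f| == 2, f \subset verts G & f \notin edges G].

Definition neighbors G (v : U) : {set U} := [set u | [set u; v] \in edges G].

Definition independent G : bool := indep (edges G).

Definition implied G (f : {set U}) : Prop :=
  nonedge G f /\
  exists C : {set {set U}}, [/\ C \subset f |: edges G, circuit C & f \in C].

Definition induced F A : {set {set U}} := [set e in F | e \subset A].

Definition add_pairs G F : {set {set U}} := edges G :|: induced F (verts G).

Definition pairs_in W : {set {set U}} := [set f : {set U} | (#|f| == 2) && (f \subset W)].

Definition two_thin_cover G (X : {set {set U}}) : Prop :=
  [/\ forall A, A \in X -> (A \subset verts G) && (2 <= #|A|)%N,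
      forall A B, A \in X -> B \in X -> A != B ->
        (#|A :&: B| <= 2)%N && ~~ (A \subset B)
    & forall e, e \in edges G -> exists2 A, A \in X & e \subset A].

Definition shared (X : {set {set U}}) : {set {set U}} :=
  [set f : {set U} | (#|f| == 2) &&
     [exists A in X, exists B in X, (A != B) && (A :&: B == f)]].

Definition independent_cover (X : {set {set U}}) : bool := indep (shared X).

Definition cover_deg (X : {set {set U}}) (e : {set U}) : nat :=
  #|[set A in X | e \subset A]|.

Definition IE_ K G (X : {set {set U}}) : int :=
  \sum_(A in X) (rk (induced (add_pairs G (shared X :|: K)) A))%:Z
  - \sum_(e in shared X :|: K) ((cover_deg X e)%:Z - 1).

Definition IE G (X : {set {set U}}) : int := IE_ set0 G X.

(* Pairs of distinct vertices of W contained in a common cluster of X. *)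
Definition key_pairs (X : {set {set U}}) W : {set {set U}} :=
  [set f in pairs_in W | [exists A in X, f \subset A]].

Section Split.
Variables (G : graph) (X : {set {set U}}) (a b a1 a2 b1 b2 : U) (Gs : graph).

Definition split_verts : {set U} := [set a1; a2; b1; b2].

(* One of the two parts of the partition of N(a) (or of N(b)) may be empty. *)
Definition nonedge_split : Prop :=
  [/\ [/\ a != b & nonedge G [set a; b]],
      uniq [:: a1; a2; b1; b2] /\ [disjoint split_verts & verts G],
      verts Gs = (verts G :\: [set a; b]) :|: split_verts,
      induced (edges Gs) (verts G :\: [set a; b]) =
        induced (edges G) (verts G :\: [set a; b])
    & [/\ neighbors Gs a1 :|: neighbors Gs a2 = neighbors G a,
          [disjoint neighbors Gs a1 & neighbors Gs a2],
          neighbors Gs b1 :|: neighbors Gs b2 = neighbors G b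
        & [disjoint neighbors Gs b1 & neighbors Gs b2]]].

Definition split_cluster A : {set U} :=
  (A :\: [set a; b]) :|:
  [set w in split_verts | [exists v in A, v \in neighbors Gs w]].

Definition unmerged A : bool :=
  ~~ ([set a1; a2] \subset A) && ~~ ([set b1; b2] \subset A).

Definition split_consistent (c d c1 c2 : U) : Prop :=
  forall A B u, A \in X -> B \in X -> A != B ->
    A :&: B = [set c; u] -> u != d -> nonedge G [set c; u] ->
    split_cluster A :&: [set c1; c2] = split_cluster B :&: [set c1; c2].

Definition safe_nonedge_split : Prop :=
  [/\ two_thin_cover G X, nonedge_split, [set a; b] \in shared X,
      forall A f, A \in X -> f \in shared X -> f \subset A -> nonedge G f ->
        unmerged (split_cluster A)
    & split_consistent a b a1 a2 /\ split_consistent b a b1 b2].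

Definition kept_clusters : {set {set U}} :=
  [set A in split_cluster @: X | (2 < #|A|)%N && unmerged A].

Definition safe_split_cover : {set {set U}} :=
  kept_clusters :|:
  [set e in edges Gs | ~~ [exists A in kept_clusters, e \subset A]].

Definition key_gluing_pairs : {set {set U}} :=
  key_pairs safe_split_cover split_verts.

Definition gluing_verts W : Prop :=
  W \subset split_verts /\ (forall f, f \in key_gluing_pairs -> f \subset W).

End Split.

Definition safe_base_graph G (X : {set {set U}}) : Prop :=
  [/\ independent G, two_thin_cover G X, independent_cover X,
      (rk (edges G))%:Z = IE G X
    & exists a b a1 a2 b1 b2 Gs, safe_nonedge_split G X a b a1 a2 b1 b2 Gs].

(* W is the set of gluing vertices. *)
Definition safe_ear H (X : {set {set U}}) W : Prop :=
  [/\ two_thin_cover H X /\ independent_cover X,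
      W \subset verts H,
      forall A, A \in X -> (#|A :&: W| <= 2)%N,
      indep (shared X :|: pairs_in W)
    & (rk (edges H))%:Z = IE_ (key_pairs X W) H X - 1].

(* J is obtained from Gs and H by identifying each x in WH with s x in W. *)
Definition glued (Gs : graph) W H (WH : {set U}) (s : U -> U) (J : graph) : Prop :=
  let g := fun x => if x \in WH then s x else x in
  [/\ {in WH &, injective s}, s @: WH = W,
      verts J = verts Gs :|: g @: verts H
    & edges J = edges Gs :|: [set g @: e | e : {set U} in edges H]].

Definition safe_split_and_glue G (X : {set {set U}}) H (XH : {set {set U}})
    (WH : {set U}) (J : graph) : Prop :=
  exists a b a1 a2 b1 b2 Gs W s,
  [/\ safe_nonedge_split G X a b a1 a2 b1 b2 Gs,
      [disjoint verts H & verts G] /\ [disjoint verts H & verts Gs],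
      gluing_verts X a b a1 a2 b1 b2 Gs W /\ glued Gs W H WH s J
    & forall x y, x \in WH -> y \in WH ->
        ([set x; y] \in key_pairs XH WH) =
        ([set s x; s y] \in key_gluing_pairs X a b a1 a2 b1 b2 Gs)].

End Rigidity.

(* Main.v *)
(* Write K for the key gluing pairs, J for the glued graph.  Relabelling each
   cluster of the base cover by its copies of a and b, and counting the shared
   pair {a, b} once for every key pair it turns into, the identity
   |E(G)| = IE(G, X) becomes rank(Gs + K) <= |E(G)| + |K| - 1; on the ear side,
   rank(H + K) <= IE_K(H, XH) = rank(H) + 1.  As K is independent,
   submodularity gives rank(J + K) <= |E(G)| + |E(H)| = |E(J)|, so K lies in
   the closure of J.  If all of K were edges of J, then Gs + K would be
   independent of rank |E(G)| + |K|, against the first bound. *)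

From HB Require Import structures.
Require Import Defs.
From mathcomp Require Import all_boot all_order all_algebra all_fingroup.
From mathcomp Require Import generic_quotient mpoly zify.

Set Implicit Arguments.
Unset Strict Implicit.
Unset Printing Implicit Defensive.

Import GRing.Theory Num.Theory.
Local Open Scope ring_scope.

(** * The generic rigidity matroid *)

(** The map from [Gs] to [G] that merges copies has no inverse on vertices, so the data of [G] are
    transported to [Gs] cluster by cluster, each time by a permutation of the ambient type [U],
    under which generic rank is invariant. The union bound asks three things of the transported
    data: the ranks of the cluster graphs do not grow, the traces of the shared pairs keep their
    sizes and stay independent, and all traces lie in one set that enters through its cardinality.
    Safety keeps that set small: the [unmerged] condition leaves at most one copy of [a] and one of
    [b] in a cluster with a shared nonedge, and [split_consistent] makes each shared nonedge other
    than {a, b} have one image, whatever cluster it is seen from. Merging copies embeds these images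
    and the lifted shared edges into the shared set without {a, b}; this missing pair is the origin
    of the -1. *)

Section RowFamilies.
Variables (F : fieldType) (T : finType) (n : nat) (r : T -> 'rV[F]_n).
Implicit Types S : {set T}.

Definition rows_mx S := \matrix_(k < #|S|) r (enum_val k).

Lemma rows_mx_subP m S (B : 'M_(m, n)) :
  reflect (forall x, x \in S -> (r x <= B)%MS) (rows_mx S <= B)%MS.
Proof.
apply: (iffP row_subP) => [sB x xS | sB k]; last by rewrite rowK sB ?enum_valP.
by have := sB (enum_rank_in xS x); rewrite rowK enum_rankK_in.
Qed.

Lemma row_rows_mx S x : x \in S -> (r x <= rows_mx S)%MS.
Proof. exact/rows_mx_subP. Qed.

Lemma rows_mxS S1 S2 : S1 \subset S2 -> (rows_mx S1 <= rows_mx S2)%MS.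
Proof.
by move=> /subsetP s12; apply/rows_mx_subP => x /s12; apply: row_rows_mx.
Qed.

Lemma rows_mxU S1 S2 : (rows_mx (S1 :|: S2) <= rows_mx S1 + rows_mx S2)%MS.
Proof.
apply/rows_mx_subP => x; rewrite inE => /orP[] xS.
  exact: submx_trans (row_rows_mx xS) (addsmxSl _ _).
exact: submx_trans (row_rows_mx xS) (addsmxSr _ _).
Qed.

Lemma rank_rows_submodular S1 S2 :
  (\rank (rows_mx (S1 :|: S2)) + \rank (rows_mx (S1 :&: S2))
    <= \rank (rows_mx S1) + \rank (rows_mx S2))%N.
Proof.
rewrite -[leqRHS]mxrank_sum_cap; apply: leq_add.
  exact: mxrankS (rows_mxU _ _).
by apply: mxrankS; rewrite sub_capmx !rows_mxS ?subsetIl ?subsetIr.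
Qed.

End RowFamilies.

(** * Extension of injective ring morphisms to fraction fields *)

Section FractionMorphism.
Variables (R S : idomainType) (f : {rmorphism R -> S}).
Hypothesis f_inj : injective f.

Local Notation frac := (@FracField.tofrac _).

Definition frac_map (x : {fraction R}) : {fraction S} :=
  frac (f (\n_(repr x))) / frac (f (\d_(repr x))).

Lemma frac_numden (x : {fraction R}) :
  x = frac (\n_(repr x)) / frac (\d_(repr x)).
Proof.
have d0 := denom_ratioP (repr x).
apply: (canRL (mulfK _)); first by rewrite tofrac_eq0.
rewrite -[x in x * _]reprK; set y := repr x in d0 *.
unlock FracField.tofrac; rewrite -[LHS]FracField.pi_mul.
apply/eqmodP; rewrite /= FracField.equivfE /FracField.mulf.
by rewrite !numden_Ratio ?oner_neq0 ?mulr1 // mulrC.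
Qed.

(** Injectivity of [f] keeps denominators nonzero, so cross-multiplication shows that the
    representative chosen in [frac_map] does not matter. *)
Lemma frac_map_div p q : q != 0 ->
  frac_map (frac p / frac q) = frac (f p) / frac (f q).
Proof.
move=> q0; rewrite /frac_map; set x := frac p / frac q.
have d0 := denom_ratioP (repr x).
have fq z : z != 0 -> frac (f z) != 0.
  by rewrite tofrac_eq0 -(rmorph0 f) (inj_eq f_inj).
have fz (z : R) : z != 0 -> frac z != 0 by rewrite tofrac_eq0.
apply/eqP; rewrite eqr_div ?fq // -!tofracM tofrac_eq -!rmorphM (inj_eq f_inj).
by rewrite -tofrac_eq !tofracM -eqr_div ?fz // -frac_numden.
Qed.

Lemma frac_map_tofrac p : frac_map (frac p) = frac (f p).
Proof.
by have := @frac_map_div p 1 (oner_neq0 _); rewrite rmorph1 !tofrac1 !divr1.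
Qed.

Fact frac_map_zmod_morphism : zmod_morphism frac_map.
Proof.
move=> x y; rewrite [x]frac_numden [y]frac_numden.
have := denom_ratioP (repr x); have := denom_ratioP (repr y).
set n1 := \n_(repr x); set d1 := \d_(repr x) => d10.
move: (\n_(repr y)) (\d_(repr y)) d10 => n2 d2 d20 d10.
have fd (z : R) : z != 0 -> f z != 0 by rewrite -(rmorph0 f) (inj_eq f_inj).
rewrite -mulNr addf_div ?tofrac_eq0 // -tofracN -!tofracM -tofracD.
rewrite !frac_map_div ?mulf_neq0 //.
by rewrite -mulNr addf_div ?tofrac_eq0 ?fd // -tofracN -!tofracM -tofracD
  rmorphD !rmorphM rmorphN.
Qed.

Fact frac_map_monoid_morphism : monoid_morphism frac_map.
Proof.
split; first by rewrite -tofrac1 frac_map_tofrac rmorph1.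
move=> x y; rewrite [x]frac_numden [y]frac_numden.
have := denom_ratioP (repr x); have := denom_ratioP (repr y).
set n1 := \n_(repr x); set d1 := \d_(repr x) => d10.
move: (\n_(repr y)) (\d_(repr y)) d10 => n2 d2 d20 d10.
rewrite mulf_div -!tofracM !frac_map_div ?mulf_neq0 //.
by rewrite mulf_div !rmorphM.
Qed.

Definition frac_rmorph : {rmorphism {fraction R} -> {fraction S}} :=
  HB.pack_for {rmorphism {fraction R} -> {fraction S}} frac_map
    (GRing.isZmodMorphism.Build _ _ frac_map frac_map_zmod_morphism)
    (GRing.isMonoidMorphism.Build _ _ frac_map frac_map_monoid_morphism).

Lemma frac_rmorph_tofrac p : frac_rmorph (frac p) = frac (f p).
Proof. exact: frac_map_tofrac. Qed.

End FractionMorphism.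

(** * Rigidity matrices under vertex permutation and vertex addition *)

Section Frameworks.
Variables (U : finType) (K : fieldType) (x : U -> 'I_3 -> K).
Implicit Types (F : {set {set U}}) (p : {perm U}).

Local Notation N := #|{: U * 'I_3}|.
Local Notation "p @@: F" := [set p @: (e : {set U}) | e in F] (at level 24).

Definition framework_row (e : {set U}) : 'rV[K]_N :=
  \row_k (let: (v, i) := enum_val k in
          if v \in e then \sum_(w in e) (x v i - x w i) else 0).

Lemma perm_coord_inj p :
  injective (fun k : 'I_N => let: (v, i) := enum_val k in
                             enum_rank (p v, i) : 'I_N).
Proof.
move=> k l /=; case Ek: (enum_val k) => [v i]; case El: (enum_val l) => [w j].
move=> /enum_rank_inj[/perm_inj eqv eqi]; apply: enum_val_inj.
by rewrite Ek El eqv eqi.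
Qed.

Definition perm_coord p : 'S_N := perm (@perm_coord_inj p).

Lemma perm_coordE p v i :
  perm_coord p (enum_rank (v, i)) = enum_rank (p v, i).
Proof. by rewrite permE enum_rankK. Qed.

(** When [f] moves the coordinates of the placement as [p] moves the vertices, relabelling an edge
    amounts to applying [f] to the entries of its row and reordering the columns. Neither operation
    changes the rank of a matrix. *)
Lemma framework_row_perm (f : {rmorphism K -> K}) p (e : {set U}) :
    (forall v i, f (x v i) = x (p v) i) ->
  framework_row (p @: e) =
  col_perm (perm_coord p)^-1%g (map_mx f (framework_row e)).
Proof.
move=> fx; apply/rowP => k; rewrite mxE [RHS]mxE.
rewrite -[k](permKV (perm_coord p)) permK; move: (_ k) => {}k.
rewrite [RHS]mxE [in RHS]mxE.
rewrite -[k]enum_valK; case: (enum_val k) => v i.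
rewrite perm_coordE !enum_rankK (mem_imset _ _ (@perm_inj _ p)).
case: ifP => _; last by rewrite rmorph0.
rewrite big_imset /=; last by move=> y z _ _; apply: perm_inj.
by rewrite rmorph_sum; apply: eq_bigr => w _; rewrite rmorphB !fx.
Qed.

Lemma rank_framework_perm (f : {rmorphism K -> K}) p F :
    (forall v i, f (x v i) = x (p v) i) ->
  (\rank (rows_mx framework_row (p @@: F))
    <= \rank (rows_mx framework_row F))%N.
Proof.
move=> fx; rewrite -[leqRHS](mxrank_map f); set M := map_mx _ _.
apply: leq_trans (mxrankM_maxl M (perm_mx (perm_coord p))).
apply/mxrankS/rows_mx_subP => _ /imsetP[e eF ->].
rewrite (framework_row_perm e fx) col_permE invgK submxMr //.
by rewrite map_submx row_rows_mx.
Qed.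

(* Vertex addition: the columns of the new vertex [v] vanish on [F], and on
   the three new rows they form the matrix of edge vectors at [v]. *)
Lemma rank_framework_star F v (u : 'I_3 -> U) :
    (forall e, e \in F -> v \notin e) -> (forall j, u j != v) ->
    \det (\matrix_(j, i) (x v i - x (u j) i)) != 0 ->
  (\rank (rows_mx framework_row F) + 3
    <= \rank (rows_mx framework_row (F :|: [set [set v; u j] | j : 'I_3])))%N.
Proof.
move=> vF uv; set D := \matrix_(_, _) _ => detD; set S := _ :|: _.
pose C := \matrix_(k < N, i < 3) (k == enum_rank (v, i))%:R : 'M[K]_(N, 3).
have rowC w i : (w *m C) 0 i = w 0 (enum_rank (v, i)).
  rewrite mxE (bigD1 (enum_rank (v, i))) //= mxE eqxx mulr1 big1 ?addr0 //.
  by move=> k /negPf kv; rewrite mxE kv mulr0.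
rewrite -[leqRHS](mxrank_mul_ker _ C) addnC leq_add //.
  have Du : D \in unitmx by rewrite unitmxE unitfE.
  rewrite -[leqLHS](mxrank_unit Du); apply/mxrankS/row_subP => j.
  have -> : row j D = framework_row [set v; u j] *m C.
    apply/rowP => i; rewrite rowC !mxE enum_rankK set21.
    rewrite big_setU1 ?big_set1 /=; first by rewrite subrr add0r.
    by rewrite inE eq_sym uv.
  rewrite submxMr ?row_rows_mx // inE; apply/orP; right.
  exact: (imset_f (fun l => [set v; u l])).
apply: mxrankS; rewrite sub_capmx rows_mxS ?subsetUl //=.
apply/rows_mx_subP => e eF; apply/sub_kermxP/rowP => i.
by rewrite rowC !mxE enum_rankK (negPf (vF e eF)).
Qed.

End Frameworks.

(** * Submodularity, vertex symmetry and vertex addition for generic rank *)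

Section GenericRigidity.
Variable U : finType.
Implicit Types (F S T C : {set {set U}}) (p : {perm U}).

Local Notation N := #|{: U * 'I_3}|.
Local Notation "p @@: F" := [set p @: (e : {set U}) | e in F] (at level 24).

Lemma rkE F : rk F = \rank (rows_mx (framework_row (@generic_coord U)) F).
Proof. by []. Qed.

Lemma rk_submodular S T : (rk (S :|: T) + rk (S :&: T) <= rk S + rk T)%N.
Proof. by rewrite !rkE rank_rows_submodular. Qed.

Lemma rkS S T : S \subset T -> (rk S <= rk T)%N.
Proof. by move=> sST; rewrite !rkE; apply: mxrankS (rows_mxS _ sST). Qed.

Lemma rk_card S : (rk S <= #|S|)%N.
Proof. exact: rank_leq_row. Qed.

Lemma rkU_card S T : (rk (S :|: T) <= rk S + #|T|)%N.
Proof.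
apply: leq_trans (leq_add (leqnn _) (rk_card T)).
exact: leq_trans (leq_addr _ _) (rk_submodular S T).
Qed.

Lemma rk_indep S : indep S -> rk S = #|S|.
Proof. by move/eqP. Qed.

Lemma indepS S T : S \subset T -> indep T -> indep S.
Proof.
move=> sST /eqP rT; rewrite /indep eqn_leq rk_card /=.
have := rkU_card S (T :\: S); rewrite -{1}(setIidPr sST) setID rT.
by rewrite -[#|T|](cardsID S) (setIidPr sST) leq_add2r.
Qed.

(** The coordinates are indeterminates, so a permutation of the vertices permutes them and extends
    to an endomorphism of [coord_field]. *)
Lemma rk_perm_le p F : (rk (p @@: F) <= rk F)%N.
Proof.
rewrite !rkE.
apply: (@rank_framework_perm U _ (@generic_coord U)
  (frac_rmorph (@inj_msym _ rat (perm_coord p)))) => v i.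
 rewrite [LHS]frac_rmorph_tofrac /= /msym mmapX mmap1U.
by rewrite perm_coordE.
Qed.

Lemma perm_pairsK p F : p^-1%g @@: (p @@: F) = F.
Proof.
rewrite -imset_comp -[RHS]imset_id; apply: eq_imset => e /=.
rewrite -imset_comp -[RHS]imset_id; apply: eq_imset => x /=.
exact: permK.
Qed.

Lemma rk_perm p F : rk (p @@: F) = rk F.
Proof.
by apply/eqP; rewrite eqn_leq rk_perm_le -{1}(perm_pairsK p F) rk_perm_le.
Qed.

Lemma card_perm_pairs p F : #|p @@: F| = #|F|.
Proof. exact/card_imset/imset_inj/perm_inj. Qed.

Lemma indep_perm p F : indep (p @@: F) = indep F.
Proof. by rewrite /indep rk_perm card_perm_pairs. Qed.

Lemma rk_add_star F (v : U) (u : 'I_3 -> U) :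
    injective u -> (forall j, u j != v) -> (forall e, e \in F -> v \notin e) ->
  (rk F + 3 <= rk (F :|: [set [set v; u j] | j : 'I_3]))%N.
Proof.
move=> u_inj uv vF; rewrite !rkE; apply: rank_framework_star => //.
pose D : 'M[{mpoly rat[N]}]_3 :=
  \matrix_(j, i) ('X_(enum_rank (v, i)) - 'X_(enum_rank (u j, i))).
rewrite [X in \det X](_ : _ = map_mx (@FracField.tofrac _) D); last first.
  by apply/matrixP => j i; rewrite !mxE tofracB.
(* A polynomial is nonzero once one value is. With [v] at the origin and [u j] at minus the [j]-th
   basis vector, the edge vectors at [v] form the identity matrix. *)
rewrite det_map_mx tofrac_eq0; apply/eqP => /(congr1 (meval (fun k : 'I_N =>
  let: (w, i) := enum_val k in - (w == u i)%:R))).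
rewrite meval0 -det_map_mx; set M := map_mx _ _.
suff -> : M = 1%:M by rewrite det1 => /eqP; rewrite oner_eq0.
apply/matrixP => j i; rewrite !mxE /= mevalB !mevalXU !enum_rankK.
by rewrite eq_sym (negPf (uv i)) (inj_eq u_inj) oppr0 sub0r opprK.
Qed.

End GenericRigidity.

(** * Rank bounds from covers *)

Section Covers.
Variable U : finType.
Implicit Types (F K S T : {set {set U}}) (A : {set U}) (X : {set {set U}}).

(** Add the sets [F_ i] one at a time: the union so far contains [T], so it meets [F_ i] in at least
    the independent set [T_ i], and submodularity bounds the rise in rank by
    [rk (F_ i) - #|T_ i|]. *)
Lemma rk_union_bound (I : finType) (P : pred I) T (F_ T_ : I -> {set {set U}}) :
    (forall i, P i -> [/\ T_ i \subset T, T_ i \subset F_ i & indep (T_ i)]) ->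
  (rk (T :|: \bigcup_(i | P i) F_ i) + \sum_(i | P i) #|T_ i|
    <= #|T| + \sum_(i | P i) rk (F_ i))%N.
Proof.
move=> TF; rewrite -!(big_filter _ P).
have : all P [seq i <- index_enum I | P i] by exact: filter_all.
elim: (filter _ _) => [_|i r IHr /= /andP[/TF[sT sF iT]] /IHr {}IHr].
  by rewrite !big_nil setU0 !addn0 rk_card.
rewrite !big_cons; set R := \bigcup_(_ <- _) _ in IHr *.
have -> : T :|: (F_ i :|: R) = (T :|: R) :|: F_ i by rewrite setUA setUAC.
have := rk_submodular (T :|: R) (F_ i).
have : (#|T_ i| <= rk ((T :|: R) :&: F_ i))%N.
  rewrite -(rk_indep iT); apply: rkS; rewrite subsetI sF andbT.
  exact: subset_trans sT (subsetUl _ _).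
move=> h1 h2; rewrite addnCA addnA [leqRHS]addnCA addnA.
have arith (t c m f x y z w : nat) : (w + x <= y + z -> t <= c ->
  m + c <= w + f -> t + m + x <= f + y + z)%N by lia.
exact: arith IHr h1 h2.
Qed.

Lemma inducedS F A : induced F A \subset F.
Proof. by apply/subsetP => e; rewrite inE => /andP[]. Qed.

Lemma sum_cover_deg X T :
  (\sum_(e in T) cover_deg X e = \sum_(A in X) #|induced T A|)%N.
Proof.
transitivity (\sum_(e in T) \sum_(A in X) (e \subset A))%N.
  apply: eq_bigr => e _; rewrite /cover_deg -sum1_card.
  rewrite (eq_bigl (fun A => (A \in X) && (e \subset A))); last first.
    by move=> A; rewrite inE.
  by rewrite big_mkcondr; apply: eq_bigr => A _; case: (_ \subset _).
rewrite exchange_big; apply: eq_bigr => A _ /=; rewrite -sum1_card.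
rewrite [RHS](eq_bigl (fun e => (e \in T) && (e \subset A))); last first.
  by move=> e; rewrite inE.
by rewrite [RHS]big_mkcondr; apply: eq_bigr => e _; case: (_ \subset _).
Qed.

(** Counting incidences between pairs and clusters in two ways brings [IE_] into the shape of
    [rk_union_bound], with the pairs inside a cluster as its trace. *)
Lemma IE_card K (G : graph U) X :
  IE_ K G X = (#|shared X :|: K| +
    \sum_(A in X) rk (induced (add_pairs G (shared X :|: K)) A))%N%:Z -
    (\sum_(A in X) #|induced (shared X :|: K) A|)%N%:Z.
Proof.
rewrite /IE_ -sum_cover_deg; move: (_ :|: K) => T.
rewrite sumrB sumr_const natz PoszD !(big_morph Posz PoszD (erefl _)).
by rewrite opprB addrCA addrA.
Qed.

Lemma induced_add_pairs (G : graph U) T A :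
  A \subset verts G ->
  induced (add_pairs G T) A = induced (edges G) A :|: induced T A.
Proof.
move=> sA; apply/setP => e; rewrite !inE; case: (boolP (e \subset A)) => eA.
  by rewrite (subset_trans eA sA) !andbT.
by rewrite !andbF.
Qed.

Lemma rk_le_IE K (G : graph U) X :
    two_thin_cover G X -> indep (shared X :|: K) ->
  ((rk (edges G :|: (shared X :|: K)))%:Z <= IE_ K G X)%R.
Proof.
move=> [Xv _ Xe] iT; rewrite IE_card; set T := shared X :|: K in iT *.
have TF A : A \in X -> [/\ induced T A \subset T,
    induced T A \subset induced (add_pairs G T) A & indep (induced T A)].
  move=> AX; split; rewrite ?inducedS ?(indepS (inducedS _ _) iT) //.
  by have /andP[sA _] := Xv A AX; rewrite induced_add_pairs // subsetUr.
have arith (a s t r : nat) : (r <= a)%N -> (a + s <= t)%N ->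
  (r%:Z <= t%:Z - s%:Z)%R by lia.
apply: arith (rk_union_bound TF); apply: rkS.
rewrite subUset subsetUl andbT; apply/subsetP => e eG.
have [A AX eA] := Xe e eG; rewrite inE; apply/orP; right.
by apply/bigcupP; exists A => //; rewrite !inE eG eA.
Qed.

End Covers.

(** * Nonedge splits *)

Section NonedgeSplit.
Variables (U : finType) (G : graph U).
Variables (a b a1 a2 b1 b2 : U) (Gs : graph U).
Hypothesis splitG : nonedge_split G a b a1 a2 b1 b2 Gs.

Local Notation sv := (split_verts a1 a2 b1 b2).
Local Notation V0 := (verts G :\: [set a; b]).
Local Notation cluster := (split_cluster a b a1 a2 b1 b2 Gs).

(** Undoes the split. On edges it is a bijection from [edges Gs] to [edges G], through which pairs
    of [Gs] are counted by pairs of [G]. *)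
Definition merge_copies (x : U) : U :=
  if x \in [set a1; a2] then a else if x \in [set b1; b2] then b else x.

Lemma imset_set2 (f : U -> U) x y : f @: [set x; y] = [set f x; f y].
Proof. by rewrite imsetU1 imset_set1. Qed.

Lemma graph_edgeP (J : graph U) e :
  e \in edges J -> (#|e| == 2) && (e \subset verts J).
Proof. by case: J => V E EV /= eE; apply: (forall_inP EV). Qed.

Lemma neighbor_in (J : graph U) u v : u \in neighbors J v ->
  [/\ u \in verts J, v \in verts J & u != v].
Proof.
rewrite inE => /graph_edgeP; rewrite cards2 subUset !sub1set.
by have [//|_ /andP[_ /andP[-> ->]]] := eqVneq u v.
Qed.

Lemma split_vertsN x : x \in sv -> x \notin verts G.
Proof.
by case: splitG => _ [_ dsv] _ _ _ xs; rewrite (disjointFr dsv xs).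
Qed.

Lemma split_ab : [/\ a != b, a \in verts G & b \in verts G].
Proof.
case: splitG => [[-> /and3P[_ abG _]] _ _ _ _].
by move: abG; rewrite subUset !sub1set => /andP[].
Qed.

Lemma split_abNs : (a \notin verts Gs) /\ (b \notin verts Gs).
Proof.
have [_ aG bG] := split_ab; case: splitG => _ _ -> _ _.
have aN : a \notin sv by apply: contraL aG; apply: split_vertsN.
have bN : b \notin sv by apply: contraL bG; apply: split_vertsN.
by rewrite !inE in aN bN *; rewrite (negPf aN) (negPf bN) !eqxx !orbT.
Qed.

Lemma V0_neq x : x \in V0 -> [/\ x != a, x != b, x \in verts G & x \notin sv].
Proof.
rewrite inE => /andP[xab xG].
have xsv : x \notin sv by apply: contraL xG; apply: split_vertsN.
by move: xab; rewrite !in_set2 negb_or => /andP[].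
Qed.

Lemma mergeV0 x : x \in V0 -> merge_copies x = x.
Proof.
case/V0_neq => _ _ _; rewrite /merge_copies !inE -!orbA !negb_or.
by case/and4P => /negPf-> /negPf-> /negPf-> /negPf->.
Qed.

Lemma merge_verts x : x \in verts G -> merge_copies x = x.
Proof.
move=> xG; have : x \notin sv by apply: contraL xG; apply: split_vertsN.
rewrite /merge_copies !inE -!orbA !negb_or.
by case/and4P => /negPf-> /negPf-> /negPf-> /negPf->.
Qed.

Lemma split_uniq : uniq [:: a1; a2; b1; b2].
Proof. by case: splitG => _ []. Qed.

Lemma merge_split : [/\ merge_copies a1 = a, merge_copies a2 = a,
  merge_copies b1 = b & merge_copies b2 = b].
Proof.
have := split_uniq; rewrite /merge_copies /= !inE !negb_or -!andbA.
case/and5P => a12 ab1 ab2 a2b1 /andP[a2b2 _].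
rewrite !eqxx /= !orbT /=; split=> //.
  by rewrite ![b1 == _]eq_sym (negPf ab1) (negPf a2b1).
by rewrite ![b2 == _]eq_sym (negPf ab2) (negPf a2b2).
Qed.

Lemma split_vertsP w : w \in sv -> [\/ w = a1, w = a2, w = b1 | w = b2].
Proof.
rewrite !inE -!orbA => /or4P[] /eqP ->; by constructor.
Qed.

Lemma sub_neighbors_split w : w \in sv ->
  neighbors Gs w \subset neighbors G (merge_copies w).
Proof.
have [m1 m2 m3 m4] := merge_split; case: splitG => _ _ _ _ [Na _ Nb _].
by move=> /split_vertsP[] ->; rewrite ?m1 ?m2 ?m3 ?m4 -?Na -?Nb
  ?subsetUl ?subsetUr.
Qed.

Lemma merge_sv w : w \in sv -> merge_copies w \in [set a; b].
Proof.
have [m1 m2 m3 m4] := merge_split.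
by move=> /split_vertsP[] ->; rewrite ?m1 ?m2 ?m3 ?m4 !inE eqxx ?orbT.
Qed.

Lemma neighbor_abV0 c u : c \in [set a; b] -> u \in neighbors G c -> u \in V0.
Proof.
move=> cab /[dup] /neighbor_in[uG _ uc]; rewrite [u \in _]inE in_setD uG andbT.
case: splitG => [[_ /and3P[_ _ abN]] _ _ _ _] => uE.
apply: contra abN => uab; suff -> : [set a; b] = [set u; c] by [].
move: cab uab uc; rewrite !inE => /orP[]/eqP-> /orP[]/eqP->;
  by rewrite ?eqxx // setUC.
Qed.

Lemma neighbor_splitV0 u w : w \in sv -> u \in neighbors Gs w -> u \in V0.
Proof.
move=> wsv /(subsetP (sub_neighbors_split wsv)).
exact/neighbor_abV0/merge_sv.
Qed.

Variant split_edge_spec (e : {set U}) : Prop :=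
| OldEdge of e \subset V0 & e \in edges G
| NewEdge u w of w \in sv & u \in V0 & u \in neighbors Gs w & e = [set u; w].

Lemma split_edgeP e : e \in edges Gs -> split_edge_spec e.
Proof.
move=> /[dup] eE /graph_edgeP /andP[/cards2P[x [y [xy def_e]]]].
case: (splitG) => _ _ -> indE _; rewrite def_e subUset !sub1set.
rewrite [x \in _]inE [y \in _]inE => /andP[xG yG].
case: (boolP (y \in sv)) => ysv.
  have xy' : x \in neighbors Gs y by rewrite inE -def_e.
  by apply: (NewEdge ysv (neighbor_splitV0 ysv xy') xy').
case: (boolP (x \in sv)) => xsv.
  have xy' : y \in neighbors Gs x by rewrite inE setUC -def_e.
  by apply: (NewEdge xsv (neighbor_splitV0 xsv xy') xy'); rewrite setUC.
rewrite (negPf xsv) (negPf ysv) !orbF in xG yG.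
have eV : e \subset V0 by rewrite def_e subUset !sub1set xG yG.
apply: OldEdge; rewrite -?def_e //.
have : e \in induced (edges Gs) V0 by rewrite inE eE.
by rewrite indE inE => /andP[].
Qed.

(** Since {a, b} is a nonedge, every neighbour of a copy lies in [V0]. Hence no key pair is an edge
    of [Gs], and [Gs] has no edge between two gluing vertices. *)
Lemma split_edge_sub e : e \in edges Gs -> ~~ (e \subset sv).
Proof.
have V0sv u : u \in V0 -> u \notin sv by case/V0_neq.
move=> /[dup] /graph_edgeP /andP[/cards2P[x [y [_ def_e]]] _].
case/split_edgeP => [eV _ | u w _ uV _ {}def_e]; apply/subsetPn.
  by exists x; [|apply/V0sv/(subsetP eV)]; rewrite def_e set21.
by exists u; [rewrite def_e set21 | apply: V0sv].
Qed.

Lemma old_edge e : e \in edges G -> e \subset V0 -> e \in edges Gs.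
Proof.
move=> eG eV; have : e \in induced (edges G) V0 by rewrite inE eG.
by case: splitG => _ _ _ <- _; rewrite inE => /andP[].
Qed.

Lemma mergeV0_set (e : {set U}) : e \subset V0 -> merge_copies @: e = e.
Proof.
move=> /subsetP eV; rewrite -[RHS]imset_id.
by apply: eq_in_imset => x /eV /mergeV0.
Qed.

Lemma merge_edge e : e \in edges Gs -> merge_copies @: e \in edges G.
Proof.
case/split_edgeP => [eV | u w wsv uV uw ->]; first by rewrite mergeV0_set.
rewrite imset_set2 mergeV0 //.
by have := subsetP (sub_neighbors_split wsv) u uw; rewrite inE.
Qed.

Lemma neighbors_split_inj w w' u : w \in sv -> w' \in sv ->
    merge_copies w = merge_copies w' ->
  u \in neighbors Gs w -> u \in neighbors Gs w' -> w = w'.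
Proof.
have [m1 m2 m3 m4] := merge_split; have [ab _ _] := split_ab.
have ba : b == a = false by rewrite eq_sym (negPf ab).
case: splitG => _ _ _ _ [_ Da _ Db].
move=> /split_vertsP[] -> /split_vertsP[] ->; 
  rewrite ?m1 ?m2 ?m3 ?m4 // => E uw uw';
  first [ by move: ab; rewrite ?E eqxx | by move: ab; rewrite -?E eqxx
        | by rewrite (disjointFr Da uw) in uw'
        | by rewrite (disjointFl Da uw) in uw'
        | by rewrite (disjointFr Db uw) in uw'
        | by rewrite (disjointFl Db uw) in uw'].
Qed.

(** In a merged new edge exactly one end lies in {a, b}, so the two ends can be told apart. The end
    in [V0] then determines the copy, because the two copies of a vertex have disjoint
    neighbourhoods. *)
Lemma merge_edge_inj :
  {in edges Gs &, injective (fun e : {set U} => merge_copies @: e)}.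
Proof.
have abV c : c \in [set a; b] -> c \in V0 = false by rewrite in_setD => ->.
move=> e e' /split_edgeP[eV _ | u w wsv uV uw ->]
  /split_edgeP[eV' _ | u' w' wsv' uV' uw' ->];
  rewrite ?imset_set2 ?mergeV0_set //.
- move=> E; have : merge_copies w' \in e by rewrite E !inE eqxx orbT.
  by move/(subsetP eV); rewrite abV ?merge_sv.
- move=> E; have : merge_copies w \in e' by rewrite -E !inE eqxx orbT.
  by move/(subsetP eV'); rewrite abV ?merge_sv.
rewrite (mergeV0 uV) (mergeV0 uV') => E.
have eu : u = u'.
  have : u \in [set u'; merge_copies w'] by rewrite -E set21.
  by rewrite !inE => /orP[]/eqP // uu; move: uV; rewrite uu abV ?merge_sv.
have ew : merge_copies w = merge_copies w'.
  have : merge_copies w \in [set u'; merge_copies w'] by rewrite -E set22.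
  by rewrite !inE => /orP[]/eqP // uu; move: uV'; rewrite -uu abV ?merge_sv.
by rewrite eu in uw *; rewrite (neighbors_split_inj wsv wsv' ew uw uw').
Qed.

Lemma merge_edge_surj e : e \in edges G ->
  exists2 e', e' \in edges Gs & merge_copies @: e' = e.
Proof.
have [m1 m2 m3 m4] := merge_split.
move=> eG; have /andP[/cards2P[x [y [xy def_e]]] eV] := graph_edgeP eG.
have new c u : c \in [set a; b] -> e = [set u; c] ->
    exists2 e', e' \in edges Gs & merge_copies @: e' = e.
  move=> cab def_e'; have uc : u \in neighbors G c by rewrite inE -def_e'.
  have uV := neighbor_abV0 cab uc.
  suff [w wsv /andP[uw /eqP mw]] :
      exists2 w, w \in sv & (u \in neighbors Gs w) && (merge_copies w == c).
    exists [set u; w]; first by move: uw; rewrite inE.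
    by rewrite imset_set2 mw mergeV0.
  case: splitG => _ _ _ _ [Na _ Nb _].
  move: cab uc; rewrite in_set2 => /orP[]/eqP->;
    rewrite -?Na -?Nb inE => /orP[] uw;
    [exists a1 | exists a2 | exists b1 | exists b2];
    by rewrite ?uw ?m1 ?m2 ?m3 ?m4 ?eqxx // !inE eqxx ?orbT.
case: (boolP (e \subset V0)) => [eV0 | ].
  by exists e; rewrite ?mergeV0_set ?old_edge.
case/subsetPn => c ce cV; have cab : c \in [set a; b].
  by move: cV; rewrite in_setD (subsetP eV) // andbT negbK.
have : c \in [set x; y] by rewrite -def_e.
rewrite in_set2 => /orP[]/eqP ec; rewrite ec in cab.
  by apply: (new x y cab); rewrite def_e setUC.
exact: (new y x cab).
Qed.

Lemma merge_edges : [set merge_copies @: e | e : {set U} in edges Gs] = edges G.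
Proof.
apply/setP => e.
apply/imsetP/idP => [[e' e'E ->] | /merge_edge_surj[e' e'E <-]].
  exact: merge_edge.
by exists e'.
Qed.

Lemma card_split_edges : #|edges Gs| = #|edges G|.
Proof. by rewrite -merge_edges (card_in_imset merge_edge_inj). Qed.

Definition copy_in (A : {set U}) (c c1 c2 : U) : U :=
  if c1 \in cluster A then c1 else if c2 \in cluster A then c2 else c.

(* The copy of [a] in the split cluster of [A] replaces [a], except that [a]
   stays put when that cluster has no copy of it: [a] and [b] are not vertices
   of [Gs], so they are free to serve as additional, edgeless copies. *)
Definition relabel (A : {set U}) : {perm U} :=
  (tperm a (copy_in A a a1 a2) * tperm b (copy_in A b b1 b2))%g.

Lemma copy_in_cases A c c1 c2 :
  [\/ copy_in A c c1 c2 = c, copy_in A c c1 c2 = c1 | copy_in A c c1 c2 = c2].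
Proof.
rewrite /copy_in; case: (c1 \in _); first by constructor 2.
by case: (c2 \in _); [constructor 3 | constructor 1].
Qed.

Lemma vsplit_neq x w : x \in verts G -> w \in sv -> (x == w) = false.
Proof.
move=> xG; apply: contraTF => /eqP <-.
by apply: contraL xG; apply: split_vertsN.
Qed.

Lemma in_sv : [/\ a1 \in sv, a2 \in sv, b1 \in sv & b2 \in sv].
Proof. by rewrite !inE !eqxx !orbT. Qed.

Lemma copy_neq A x : x \in verts G ->
  (x != a -> x != copy_in A a a1 a2) /\ (x != b -> x != copy_in A b b1 b2).
Proof.
move=> xG; have [i1 i2 i3 i4] := in_sv.
split=> xn; [have := copy_in_cases A a a1 a2 | have := copy_in_cases A b b1 b2];
  by case=> ->; rewrite ?(vsplit_neq xG i1) ?(vsplit_neq xG i2)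
    ?(vsplit_neq xG i3) ?(vsplit_neq xG i4).
Qed.

Lemma copy_copy A : copy_in A a a1 a2 != copy_in A b b1 b2.
Proof.
have [m1 m2 m3 m4] := merge_split; have [ab aG bG] := split_ab.
apply: contra_neq ab => /(congr1 merge_copies).
by case: (copy_in_cases A a a1 a2) => ->; case: (copy_in_cases A b b1 b2) => ->;
  rewrite ?m1 ?m2 ?m3 ?m4 ?merge_verts.
Qed.

Lemma relabelE A x : x \in verts G ->
  relabel A x = if x == a then copy_in A a a1 a2
                else if x == b then copy_in A b b1 b2 else x.
Proof.
move=> xG; rewrite permM; have [ab aG bG] := split_ab.
have [xca xcb] := copy_neq A xG.
case: eqVneq => [-> | xa].
  have [nba _] := copy_neq A bG; rewrite tpermL tpermD //.
    by rewrite nba // eq_sym.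
  by rewrite eq_sym copy_copy.
rewrite (@tpermD _ a) 1?eq_sym // ?xca //; case: eqVneq => [-> | xb].
  by rewrite tpermL.
by apply: tpermD => //; rewrite eq_sym xcb // eq_sym.
Qed.

Lemma merge_relabel A x : x \in verts G -> merge_copies (relabel A x) = x.
Proof.
have [m1 m2 m3 m4] := merge_split; have [ab aG bG] := split_ab.
move=> xG; rewrite relabelE //; case: eqVneq => [-> | _].
  by case: (copy_in_cases A a a1 a2) => ->; rewrite ?m1 ?m2 ?merge_verts.
case: eqVneq => [-> | _]; last by rewrite merge_verts.
by case: (copy_in_cases A b b1 b2) => ->; rewrite ?m3 ?m4 ?merge_verts.
Qed.

Lemma merge_relabel_set A (e : {set U}) : e \subset verts G ->
  merge_copies @: (relabel A @: e) = e.
Proof.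
move=> /subsetP eG; rewrite -imset_comp -[RHS]imset_id.
by apply: eq_in_imset => x /eG xG; apply: merge_relabel.
Qed.

Lemma relabelV0 A x : x \in V0 -> relabel A x = x.
Proof.
by case/V0_neq => xa xb xG _; rewrite relabelE // (negPf xa) (negPf xb).
Qed.

(** A neighbour in [A] pulls the copy [w] into the split cluster. That cluster is unmerged, so [w]
    is the copy that [copy_in] selects. *)
Lemma relabel_edge A e : unmerged a1 a2 b1 b2 (cluster A) ->
  e \in edges G -> e \subset A -> relabel A @: e \in edges Gs.
Proof.
have [m1 m2 m3 m4] := merge_split; have [ab aG bG] := split_ab.
move=> /andP[]; rewrite !subUset !sub1set => una unb.
move=> /merge_edge_surj[e' e'E <-]; case: (split_edgeP e'E) => [eV _ | ].
  rewrite mergeV0_set // => _; suff -> : relabel A @: e' = e' by [].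
  rewrite -[RHS]imset_id.
  by apply: eq_in_imset => x /(subsetP eV) /relabelV0.
move=> u w wsv uV uw def_e; move: e'E; rewrite def_e imset_set2 (mergeV0 uV).
move=> e'E; rewrite subUset !sub1set => /andP[uA _].
have wA : w \in cluster A.
  rewrite inE; apply/orP; right; rewrite inE wsv.
  by apply/existsP; exists u; rewrite uA.
rewrite imset_set2 relabelV0 // (_ : relabel A (merge_copies w) = w) //.
move: una unb wA.
case/split_vertsP: wsv => ->; rewrite ?m1 ?m2 ?m3 ?m4 relabelE ?eqxx //
  ?(eq_sym b a) ?(negPf ab) /copy_in => + + wA; rewrite ?wA //= ?andbT.
- by move=> /negPf->.
- by move=> _ /negPf->.
Qed.

End NonedgeSplit.

(** * Rank bound for a safe split with its key pairs *)

Section SafeSplit.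
Variables (U : finType) (G : graph U) (X : {set {set U}}).
Variables (a b a1 a2 b1 b2 : U) (Gs : graph U).
Implicit Types (A B e f : {set U}) (F T : {set {set U}}).
Hypothesis safe : safe_nonedge_split G X a b a1 a2 b1 b2 Gs.

Local Notation sv := (split_verts a1 a2 b1 b2).
Local Notation cluster := (split_cluster a b a1 a2 b1 b2 Gs).
Local Notation relabel := (relabel a b a1 a2 b1 b2 Gs).
Local Notation merge_copies := (merge_copies a b a1 a2 b1 b2).
Local Notation K := (key_gluing_pairs X a b a1 a2 b1 b2 Gs).
Local Notation "p @@: F" := [set p @: (e : {set U}) | e in F] (at level 24).

Let splitG : nonedge_split G a b a1 a2 b1 b2 Gs.
Proof. by case: safe. Qed.

Let coverX : two_thin_cover G X.
Proof. by case: safe. Qed.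

Lemma cluster_verts A : A \in X -> A \subset verts G.
Proof. by case: coverX => Xv _ _ /Xv /andP[]. Qed.

Lemma sharedP f : f \in shared X -> #|f| = 2 /\ f \subset verts G.
Proof.
rewrite inE => /andP[/eqP-> /exists_inP[A AX /exists_inP[B BX]]].
case/andP => _ /eqP<-.
by split=> //; apply: subset_trans (subsetIl _ _) (cluster_verts AX).
Qed.

Lemma cluster_capE A B f : A \in X -> B \in X -> A != B -> #|f| = 2 ->
  f \subset A -> f \subset B -> A :&: B = f.
Proof.
move=> AX BX AB f2 fA fB; case: coverX => _ /(_ A B AX BX AB) /andP[AB2 _] _.
by apply/eqP; rewrite eq_sym eqEcard subsetI fA fB f2.
Qed.

(* Clusters without a shared nonedge may have merging copies; there all shared
   pairs are edges and are tracked edge by edge instead. *)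
Definition has_shared_nonedge (A : {set U}) : bool :=
  [exists f in shared X, (f \subset A) && (f \notin edges G)].

Lemma shared_nonedge_unmerged A : A \in X -> has_shared_nonedge A ->
  unmerged a1 a2 b1 b2 (cluster A).
Proof.
move=> AX /exists_inP[f fS /andP[fA fG]]; case: safe => _ _ _ + _.
apply; [exact: AX | exact: fS | exact: fA |].
by rewrite /nonedge fG andbT; have [-> ->] := sharedP fS.
Qed.

Lemma copy_consistent A B c c1 c2 :
    cluster A :&: [set c1; c2] = cluster B :&: [set c1; c2] ->
  copy_in a b a1 a2 b1 b2 Gs A c c1 c2 = copy_in a b a1 a2 b1 b2 Gs B c c1 c2.
Proof.
move=> /setP E; have := E c1; have := E c2; rewrite /copy_in.
by rewrite ![_ \in _ :&: _]in_setI set21 set22 !andbT => -> ->.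
Qed.

(** By 2-thinness the two clusters meet exactly in [f], so [split_consistent] equates their copies
    of [a] or of [b]. The pair {a, b} escapes that condition: its images may differ, and they are
    counted as key or spare pairs. *)
Lemma relabel_consistent A B f : A \in X -> B \in X -> f \in shared X ->
    f \notin edges G -> f != [set a; b] -> f \subset A -> f \subset B ->
  relabel A @: f = relabel B @: f.
Proof.
move=> AX BX fS fG fab fA fB; have [-> // | AB] := eqVneq A B.
have [f2 fV] := sharedP fS; have AfB := cluster_capE AX BX AB f2 fA fB.
have [ab aG bG] := split_ab splitG.
case: safe => _ _ _ _ [consa consb].
have shared_pair c : c \in f ->
    exists2 u, u \in verts G & f = [set c; u] /\ u != c.
  move=> cf; have /cards1P[u fu] : #|f :\ c| == 1.
    by move: f2; rewrite (cardsD1 c) cf add1n => -[->].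
  have : u \in f :\ c by rewrite fu inE.
  rewrite in_setD1 => /andP[uc uf]; exists u; first exact: (subsetP fV).
  by rewrite -fu setD1K.
have nonedge_f : nonedge G f by rewrite /nonedge f2 fV fG.
apply: eq_in_imset => x xf; have xG := subsetP fV x xf.
rewrite !(relabelE splitG) //; case: eqVneq => [xa | _].
  rewrite xa in xf; have [u uG [def_f ua]] := shared_pair a xf.
  apply: copy_consistent; apply: (consa A B u) => //; rewrite -?def_f //.
  by apply: contraNneq fab => <-; rewrite -def_f.
case: eqVneq => [xb | //].
rewrite xb in xf; have [u uG [def_f ua]] := shared_pair b xf.
apply: copy_consistent; apply: (consb A B u) => //; rewrite -?def_f //.
by apply: contraNneq fab => <-; rewrite setUC -def_f.
Qed.

Definition star (v u0 u1 u2 : U) : {set {set U}} :=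
  [set [set v; u] | u in [set u0; u1; u2]].

Lemma rk_star F (v u0 u1 u2 : U) :
    uniq [:: v; u0; u1; u2] -> (forall e, e \in F -> v \notin e) ->
  (rk F + 3 <= rk (F :|: star v u0 u1 u2))%N.
Proof.
move=> uq vF; pose u := tnth [tuple u0; u1; u2].
have uv j : u j != v.
  move: uq => /andP[vu _]; apply: contraNneq vu => <-.
  exact: (mem_tnth j [tuple u0; u1; u2]).
have u_inj : injective u.
  by apply/tuple_uniqP; move: uq => /andP[].
apply: leq_trans (rk_add_star u_inj uv vF) (rkS _); apply: setUS.
apply/subsetP => _ /imsetP[j _ ->]; apply: imset_f.
have := mem_tnth j [tuple u0; u1; u2].
by rewrite !inE => /or3P[] ->; rewrite ?orbT.
Qed.

Lemma card_star (v u0 u1 u2 : U) : (#|star v u0 u1 u2| <= 3)%N.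
Proof.
apply: leq_trans (leq_imset_card _ _) _.
by rewrite -setUA !cardsU1 cards1; do 2! case: (_ \notin _).
Qed.

(* An image of {a, b} that is not a key pair involves [a] or [b] and so is one
   of these pairs.  They attach [b] and then [a] as vertices of degree three,
   hence cost exactly their number in rank and cancel from the count. *)
Definition spare : {set {set U}} := star b a1 a2 b1 :|: star a b b1 b2.

Lemma rk_spare F : (forall e, e \in F -> e \subset verts Gs) ->
  (rk F + 6 <= rk (F :|: spare))%N.
Proof.
move=> FV; have [aNs bNs] := split_abNs splitG.
have [ab aG bG] := split_ab splitG; have := split_uniq splitG.
have [i1 i2 i3 i4] := in_sv a1 a2 b1 b2.
have aN w : w \in sv -> (a == w) = false by apply: (vsplit_neq splitG).
have bN w : w \in sv -> (b == w) = false by apply: (vsplit_neq splitG).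
rewrite /= !inE !negb_or -!andbA.
case/and5P => a12 a1b1 a1b2 a2b1 /and3P[a2b2 b12 _].
have vF v e : v \notin verts Gs -> e \in F -> v \notin e.
  by move=> vN /FV /subsetP eV; apply: contra vN => /eV.
rewrite setUA (_ : rk F + 6 = rk F + 3 + 3)%N; last by rewrite -addnA.
apply: leq_trans (rk_star _ _); first rewrite leq_add2r.
- apply: rk_star => [|e]; last exact: vF.
  by rewrite /= !inE !negb_or !bN // a12 a1b1 a2b1.
- by rewrite /= !inE !negb_or (aN _ i3) (aN _ i4) (bN _ i3) (bN _ i4) ab b12.
move=> e; rewrite inE => /orP[/(vF _ _ aNs) // | /imsetP[u uE ->]].
rewrite in_set2 negb_or ab /=; move: uE; rewrite !inE -orbA.
by case/or3P => /eqP->; rewrite aN.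
Qed.

Lemma card_spare : (#|spare| <= 6)%N.
Proof.
apply: leq_trans (leq_card_setU _ _) _.
exact: (leq_add (card_star _ _ _ _) (card_star _ _ _ _)).
Qed.

Lemma key_gluing_pairP f : f \in K -> #|f| = 2 /\ f \subset sv.
Proof. by rewrite !inE => /andP[/andP[/eqP]]. Qed.

(** A copy enters a split cluster only through a neighbour in [A], which survives the split. Joined
    to two copies, this third vertex meets the size condition of [kept_clusters]. *)
Lemma cluster_neighbor A w : w \in sv -> w \in cluster A -> A \subset verts G ->
  exists2 v, v \in cluster A & v \notin sv.
Proof.
move=> wsv; rewrite inE => /orP[|] wA AV.
  move: wA; rewrite inE => /andP[_ /(subsetP AV)].
  by rewrite (negPf (split_vertsN splitG wsv)).
move: wA; rewrite inE => /andP[_ /exists_inP[v vA vw]].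
have [va vb vG vsv] := V0_neq splitG (neighbor_splitV0 splitG wsv vw).
by exists v => //; rewrite inE in_setD vA in_set2 negb_or va vb.
Qed.

Lemma copy_in_cluster A c c1 c2 (x := copy_in a b a1 a2 b1 b2 Gs A c c1 c2) :
  x = c \/ x \in [set c1; c2] /\ x \in cluster A.
Proof.
rewrite /x /copy_in; case: ifP => [c1A | _]; first by right; rewrite set21.
by case: ifP => [c2A | _]; [right; rewrite set22 | left].
Qed.

Lemma key_gluing_pair_cluster A w z : A \in X -> has_shared_nonedge A ->
  w \in cluster A -> z \in cluster A -> w \in sv -> z \in sv -> w != z ->
  [set w; z] \in K.
Proof.
move=> AX nA wA zA wsv zsv wz.
have wzA : [set w; z] \subset cluster A by rewrite subUset !sub1set wA.
rewrite !inE cards2 wz subUset !sub1set wsv zsv /=.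
apply/exists_inP; exists (cluster A) => //; rewrite inE; apply/orP; left.
rewrite inE imset_f // shared_nonedge_unmerged // andbT /=.
have [v vA vsv] := cluster_neighbor wsv wA (cluster_verts AX).
have vwz : v \notin [set w; z].
  by rewrite in_set2 negb_or; apply/andP; split; apply: contraNneq vsv => ->.
have : v |: [set w; z] \subset cluster A by rewrite subUset sub1set vA.
by move/subset_leq_card; rewrite cardsU1 vwz cards2 wz.
Qed.

Lemma relabel_ab A : A \in X -> has_shared_nonedge A -> [set a; b] \subset A ->
  relabel A @: [set a; b] \in K :|: spare.
Proof.
move=> AX nA abA; have [ab aG bG] := split_ab splitG.
have [i1 i2 i3 i4] := in_sv a1 a2 b1 b2.
rewrite imset_set2 !(relabelE splitG) // eqxx eq_sym (negPf ab) eqxx inE.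
have := copy_copy splitG A.
have := copy_in_cluster A b b1 b2; have := copy_in_cluster A a a1 a2.
move: (copy_in _ _ _ _ _ _ _ _ _ _ _) => x.
move: (copy_in _ _ _ _ _ _ _ _ _ _ _) => y.
have star_r u : u \in [set b; b1; b2] -> [set a; u] \in spare.
  move=> uE; rewrite inE; apply/orP; right.
  exact: (imset_f (fun u => [set a; u])).
have star_l u : u \in [set a1; a2; b1] -> [set b; u] \in spare.
  move=> uE; rewrite inE; apply/orP; left.
  exact: (imset_f (fun u => [set b; u])).
case=> [-> | [xa xA]].
  case=> [-> _ | [yb _] _]; rewrite star_r ?orbT //; first by rewrite !inE eqxx.
  by rewrite -setUA in_setU yb orbT.
case=> [-> _ | [yb yA] xy]; apply/orP.
  by right; rewrite setUC star_l // in_setU xa.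
left; apply: (key_gluing_pair_cluster AX) => //.
  by move: xa; rewrite !inE => /orP[] ->; rewrite ?orbT.
by move: yb; rewrite !inE => /orP[] ->; rewrite ?orbT.
Qed.

Lemma edge_in_cluster e : e \in edges G -> exists2 A, A \in X & e \subset A.
Proof. by case: coverX => _ _; apply. Qed.

Hypotheses (indG : independent G) (indS : indep (shared X)).
Hypotheses (rkG : (rk (edges G))%:Z = IE G X) (indGs : indep (edges Gs)).

Local Notation S := (shared X).

(** The data for [rk_union_bound] in [Gs]: [split_pairs] are the traces, [split_graph] the cluster
    graphs, and [split_shared] is the common set apart from key and spare pairs. *)
Let split_pairs (A : {set U}) : {set {set U}} :=
  if has_shared_nonedge A then relabel A @@: induced S A
  else [set e in edges Gs | merge_copies @: e \in induced S A].

Let split_graph (A : {set U}) : {set {set U}} :=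
  if has_shared_nonedge A then relabel A @@: induced (add_pairs G S) A
  else [set e in edges Gs | merge_copies @: e \subset A].

Let split_shared : {set {set U}} :=
  [set e in edges Gs | merge_copies @: e \in S] :|:
  \bigcup_(A in X) relabel A @@:
     [set e in induced S A | (e \notin edges G) && (e != [set a; b])].

Lemma all_shared_edges A f : has_shared_nonedge A = false -> f \in S ->
  f \subset A -> f \in edges G.
Proof.
move=> /negbT /existsPn /(_ f) + fS fA; rewrite fS fA /=.
by rewrite negbK.
Qed.

Lemma card_preim_merge (T : {set {set U}}) : T \subset edges G ->
  #|[set e in edges Gs | merge_copies @: e \in T]| = #|T|.
Proof.
move=> sT; pose f (e : {set U}) := merge_copies @: e.
rewrite -(card_in_imset (f := f)); last first.
  move=> e e'; rewrite !inE => /andP[eE _] /andP[eE' _].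
  exact: (merge_edge_inj splitG).
congr #|pred_of_set _|; apply/setP => e; apply/imsetP/idP => [[e'] | eT].
  by rewrite inE => /andP[_ e'T] ->.
have [e' e'E Ee] := merge_edge_surj splitG (subsetP sT e eT).
by exists e'; rewrite // inE e'E Ee.
Qed.

Lemma card_split_pairs A : A \in X -> #|split_pairs A| = #|induced S A|.
Proof.
move=> AX; rewrite /split_pairs; case: ifP => nA; first exact: card_perm_pairs.
apply: card_preim_merge; apply/subsetP => f; rewrite inE => /andP[fS fA].
exact: all_shared_edges fA.
Qed.

(** Relabelling preserves rank. Without a shared nonedge, the rank is at most the number of lifted
    edges, which is the rank of the edges of [G] inside [A] because [G] is independent. *)
Lemma rk_split_graph A : A \in X ->
  (rk (split_graph A) <= rk (induced (add_pairs G S) A))%N.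
Proof.
move=> AX; rewrite /split_graph; case: ifP => nA; first by rewrite rk_perm.
apply: leq_trans (rk_card _) _.
have indA : indep (induced (edges G) A) by apply: indepS (inducedS _ _) indG.
rewrite (_ : [set e in _ | _] =
    [set e in edges Gs | merge_copies @: e \in induced (edges G) A]).
  rewrite card_preim_merge ?inducedS // -(rk_indep indA); apply: rkS.
  by rewrite induced_add_pairs ?cluster_verts // subsetUl.
apply/setP => e; rewrite !inE; case: (boolP (e \in edges Gs)) => //= eE.
by rewrite (merge_edge splitG).
Qed.

(** Relabelled traces inherit independence from the shared set, lifted ones from [edges Gs]. *)
Lemma indep_split_pairs A : A \in X -> indep (split_pairs A).
Proof.
move=> AX; rewrite /split_pairs; case: ifP => nA.
  by rewrite indep_perm (indepS (inducedS _ _)).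
by apply: indepS indGs; apply/subsetP => e; rewrite inE => /andP[].
Qed.

Lemma split_pairs_sub_graph A : A \in X -> split_pairs A \subset split_graph A.
Proof.
move=> AX; rewrite /split_pairs /split_graph; case: ifP => nA.
  by apply: imsetS; rewrite induced_add_pairs ?cluster_verts // subsetUr.
by apply/subsetP => e; rewrite !inE => /andP[-> /andP[_ ->]].
Qed.

Lemma split_pairs_sub_shared A : A \in X ->
  split_pairs A \subset split_shared :|: (K :|: spare).
Proof.
move=> AX; rewrite /split_pairs; case: ifP => nA;
  apply/subsetP => e; last first.
  by rewrite [e \in _ :|: (_ :|: _)]inE !inE => /andP[-> /andP[-> _]].
case/imsetP => f /[dup] fSA; rewrite inE => /andP[fS fA] ->.
have [fab | fab] := eqVneq f [set a; b].
  by rewrite in_setU fab relabel_ab ?orbT // -fab.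
rewrite inE; apply/orP; left; rewrite inE; apply/orP.
case: (boolP (f \in edges G)) => fG; [left | right].
  have [_ fV] := sharedP fS.
  rewrite inE (relabel_edge splitG) ?shared_nonedge_unmerged //.
  by rewrite (merge_relabel_set splitG).
by apply/bigcupP; exists A => //; apply: imset_f; rewrite inE fSA fG.
Qed.

Lemma merge_split_shared_inj :
  {in split_shared &, injective (fun e : {set U} => merge_copies @: e)}.
Proof.
have mem e : e \in split_shared ->
    merge_copies @: e \in edges G /\ e \in edges Gs \/
    exists A f, [/\ A \in X, f \in S, f \subset A,
      (f \notin edges G) && (f != [set a; b])
      & e = relabel A @: f /\ merge_copies @: e = f].
  rewrite inE => /orP[|].
    by rewrite inE => /andP[eE _]; left; split=> //; apply: (merge_edge splitG).
  case/bigcupP => A AX /imsetP[f]; rewrite inE => /andP[].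
  rewrite inE => /andP[fS fA] fn ->.
  right; exists A, f; split=> //; split=> //.
  by rewrite (merge_relabel_set splitG) //; have [] := sharedP fS.
move=> e e' /mem[[eG eE]|[A [f [AX fS fA /andP[fG fab] [-> ->]]]]]
  /mem[[eG' eE']|[B [f' [BX fS' fB /andP[fG' fab'] [-> ->]]]]].
- exact: (merge_edge_inj splitG).
- by move=> E; rewrite E (negPf fG') in eG.
- by move=> E; rewrite -E (negPf fG) in eG'.
- by move=> E; rewrite -E in fB *; apply: relabel_consistent.
Qed.

(** Merging embeds [split_shared] into [S] but misses {a, b}, which is not an edge and is excluded
    among the nonedges. *)
Lemma card_split_shared : (#|split_shared| < #|S|)%N.
Proof.
rewrite -(card_in_imset merge_split_shared_inj) (cardsD1 [set a; b] S).
have -> : [set a; b] \in S by case: safe.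
rewrite add1n ltnS; apply/subset_leq_card/subsetP => f /imsetP[e].
have abG : [set a; b] \notin edges G by case: splitG => -[_ /and3P[]].
rewrite inE => /orP[| ].
  rewrite inE => /andP[eE eS] ->; rewrite in_setD1 eS andbT.
  apply: contraNneq abG => <-.
  exact: (merge_edge splitG).
case/bigcupP => A AX /imsetP[g]; rewrite inE => /andP[].
rewrite inE => /andP[gS gA] /andP[gG gab] -> ->.
by rewrite in_setD1 (merge_relabel_set splitG) ?gab //; have [] := sharedP gS.
Qed.

(** Compared with the formula for [IE G X], only the term [#|S|] gets worse: it becomes at most
    [#|S| - 1 + #|K| + 6]. The 6 is paid back by [rk_spare]. *)
Lemma rk_split_key_pairs :
  (rk (edges Gs :|: K) < #|edges G| + #|K|)%N.
Proof.
have TF A : A \in X -> [/\ split_pairs A \subset split_shared :|: (K :|: spare),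
    split_pairs A \subset split_graph A & indep (split_pairs A)].
  move=> AX; rewrite split_pairs_sub_shared ?split_pairs_sub_graph //.
  by rewrite indep_split_pairs.
have covers : edges Gs :|: K :|: spare \subset
    split_shared :|: (K :|: spare) :|: \bigcup_(A in X) split_graph A.
  rewrite -setUA subUset andbC; apply/andP; split.
    exact: subset_trans (subsetUr _ _) (subsetUl _ _).
  apply: subset_trans (subsetUr _ _); apply/subsetP => e eE.
  have mE := merge_edge splitG eE; have [A AX eA] := edge_in_cluster mE.
  apply/bigcupP; exists A => //; rewrite /split_graph; case: ifP => nA.
    (* Both sides are edges of [Gs] with the same merged edge, so injectivity of merging identifies
       them. *)
    suff <- : relabel A @: (merge_copies @: e) = e.
      by apply: imset_f; rewrite induced_add_pairs ?cluster_verts // !inE mE eA.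
    apply: (merge_edge_inj splitG) => //.
      by rewrite (relabel_edge splitG) // shared_nonedge_unmerged.
    rewrite (merge_relabel_set splitG) //.
    exact: subset_trans eA (cluster_verts AX).
  by rewrite inE eE eA.
have keyV f : f \in edges Gs :|: K -> f \subset verts Gs.
  rewrite in_setU => /orP[/graph_edgeP /andP[] // |].
  move=> /key_gluing_pairP[_ fsv]; apply: subset_trans fsv _.
  by case: splitG => _ _ -> _ _; rewrite subsetUr.
have cardT : (#|split_shared :|: (K :|: spare)|
    <= #|split_shared| + (#|K| + 6))%N.
  apply: leq_trans (leq_card_setU _ _) _; rewrite leq_add2l.
  apply: leq_trans (leq_card_setU _ _) _; rewrite leq_add2l; exact: card_spare.
have sum_pairs : (\sum_(A in X) #|split_pairs A|
    = \sum_(A in X) #|induced S A|)%N.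
  by apply: eq_bigr => A; apply: card_split_pairs.
have sum_rk : (\sum_(A in X) rk (split_graph A) <=
    \sum_(A in X) rk (induced (add_pairs G S) A))%N.
  by apply: leq_sum => A; apply: rk_split_graph.
have := rkG; rewrite /IE IE_card setU0 (rk_indep indG) => cardG.
have := rk_union_bound TF; rewrite sum_pairs.
move: (leq_trans (rk_spare keyV) (rkS covers)).
move: cardT sum_rk card_split_shared cardG.
have arith (r u t t' k s p q q' g : nat) : (u + p <= t + q)%N ->
    (t <= t' + (k + 6))%N -> (q <= q')%N -> (t' < s)%N ->
    g%:Z = (s + q')%N%:Z - p%:Z -> (r + 6 <= u)%N -> (r < g + k)%N.
  by clear; lia.
move=> ineqT ineqRk ineqS eqG ineqU ineqB.
exact: arith ineqB ineqT ineqRk ineqS eqG ineqU.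
Qed.

End SafeSplit.

(** * Gluing *)

(** Rank invariance is available for permutations of [U], so the gluing map is extended to one: the
    involution that exchanges [x] and [s x] for [x] in [W] and fixes all else. It is well defined
    because [s @: W] avoids [W]. *)
Lemma swap_perm (U : finType) (W D : {set U}) (s : U -> U) :
    {in W &, injective s} -> W \subset D -> [disjoint D & s @: W] ->
  exists p : {perm U}, forall x, x \in D -> p x = if x \in W then s x else x.
Proof.
move=> s_inj WD dis.
pose h x := if x \in W then s x else odflt x [pick y in W | s y == x].
have sN x : x \in W -> s x \in W = false.
  move=> xW; apply: contraTF (imset_f s xW) => /(subsetP WD) sxD.
  by rewrite (disjointFr dis sxD).
have hK : involutive h.
  move=> x; rewrite {2}/h; case: ifP => xW.
    rewrite /h sN //; case: pickP => [y /andP[yW /eqP /s_inj -> //] | /(_ x)].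
    by rewrite xW eqxx.
  case: pickP => [y /andP[yW /eqP sy] | no] /=; first by rewrite /h yW.
  by rewrite /h xW; case: pickP => // y; rewrite no.
exists (perm (can_inj hK)) => x xD; rewrite permE /h.
case: ifP => // xW; case: pickP => //= y /andP[yW /eqP sy].
by have := disjointFr dis xD; rewrite -sy imset_f.
Qed.

(** A minimal dependent subset has to contain [f], since the edges alone are independent. *)
Lemma circuit_implied (U : finType) (J : graph U) f :
    independent J -> nonedge J f -> ~~ indep (f |: edges J) -> implied J f.
Proof.
move=> iJ nf dep; split=> //.
have [C Cmin CJ] := @minset_exists _ (fun D => ~~ indep D) _ dep.
exists C; split=> //; apply: contraT => fC.
have /minsetp := Cmin; rewrite (indepS _ iJ) //.
apply/subsetP => e eC; have := subsetP CJ e eC.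
by rewrite in_setU1 => /orP[/eqP ef | //]; rewrite ef (negPf fC) in eC.
Qed.

Theorem theorem6 (U : finType) (G : graph U) (X : {set {set U}})
  (H : graph U) (XH : {set {set U}}) (WH : {set U}) (GsH : graph U) :
  safe_base_graph G X ->
  safe_ear H XH WH ->
  safe_split_and_glue G X H XH WH GsH ->
  independent GsH ->
  exists f : {set U}, implied GsH f.
Proof.
move=> [indG _ indS rkG _] [[coverH _] WHV _ indF rkH].
case=> a [b] [a1] [a2] [b1] [b2] [Gs] [W] [s].
case=> safe [_ disH] [[Wsv KW] glue] match_K indJ.
move: glue => [s_inj sW vertsJ edgesJ].
set K := key_gluing_pairs X a b a1 a2 b1 b2 Gs in KW match_K.
set KH := key_pairs XH WH in rkH match_K.
have splitG : nonedge_split G a b a1 a2 b1 b2 Gs by case: safe.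
have svGs : split_verts a1 a2 b1 b2 \subset verts Gs.
  by case: splitG => _ _ -> _ _; apply: subsetUr.
have WGs := subset_trans Wsv svGs.
have disW : [disjoint verts H & s @: WH].
  by rewrite sW disjoint_sym (disjointWl WGs) // disjoint_sym.
have [p pE] := swap_perm s_inj WHV disW.
have pH : [set p @: (e : {set U}) | e in edges H] =
    [set (fun x => if x \in WH then s x else x) @: (e : {set U})
      | e in edges H].
  apply: eq_in_imset => e /graph_edgeP /andP[_ /subsetP eV].
  by apply: eq_in_imset => x /eV; apply: pE.
rewrite -pH in edgesJ; set EH := [set _ | _ in edges H] in pH edgesJ.
have pWH x : x \in WH -> p x = s x.
  by move=> xW; rewrite pE ?xW // (subsetP WHV).
have KE : K = [set p @: (f : {set U}) | f in KH].
  apply/setP => f; apply/idP/imsetP => [fK | [f' f'K ->]]; last first.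
    have : f' \in pairs_in WH by move: f'K; rewrite inE => /andP[].
    rewrite inE => /andP[/cards2P[x [y [_ def_f']]]].
    rewrite def_f' subUset !sub1set => /andP[xW yW].
    by rewrite imset_set2 !pWH // -match_K // -def_f'.
  have [/eqP/cards2P[u [v [_ def_f]]] _] := key_gluing_pairP fK.
  have := KW f fK; rewrite def_f subUset !sub1set -sW.
  case/andP=> /imsetP[x xW def_u] /imsetP[y yW def_v].
  exists [set x; y]; last by rewrite imset_set2 !pWH // def_u def_v.
  by rewrite match_K // -def_u -def_v -def_f.
have KHW : KH \subset pairs_in WH by apply/subsetP => f; rewrite inE => /andP[].
have indK : indep K.
  rewrite KE indep_perm; apply: indepS indF.
  exact: subset_trans KHW (subsetUr _ _).
(* A common edge would have both ends among the gluing vertices, the only vertices the two sides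
   share, but no edge of [Gs] joins two copies. Hence the edge counts add up. *)
have disE : [disjoint edges Gs & EH].
  apply/pred0P => e /=; apply/negP => /andP[eGs /imsetP[e' e'H def_e]].
  suff /negP : ~~ (e \subset split_verts a1 a2 b1 b2).
    apply; apply: subset_trans Wsv; apply/subsetP => y ye.
    have yGs := subsetP (proj2 (andP (graph_edgeP eGs))) y ye.
    move: ye; rewrite def_e => /imsetP[x xe' def_y].
    have xV := subsetP (proj2 (andP (graph_edgeP e'H))) x xe'.
    move: def_y; rewrite pE //; case: ifP => [xW -> | _ yx].
      by rewrite -sW imset_f.
    by rewrite yx (disjointFr disH xV) in yGs.
  exact: (split_edge_sub splitG eGs).
have disK : [disjoint edges Gs & K].
  apply/pred0P => e /=; apply/negP => /andP[eGs /key_gluing_pairP[_]].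
  exact/negP/(split_edge_sub splitG eGs).
have EGsJ : edges Gs \subset edges GsH by rewrite edgesJ subsetUl.
have indGs : indep (edges Gs) := indepS EGsJ indJ.
have boundG := rk_split_key_pairs safe indG indS rkG indGs.
have boundH : (rk (EH :|: K) <= #|edges H| + 1)%N.
  rewrite KE -imsetU rk_perm.
  have indT : indep (shared XH :|: KH).
    by apply: indepS indF; apply: setUS.
  have sub : (rk (edges H :|: KH) <= rk (edges H :|: (shared XH :|: KH)))%N.
    by apply: rkS; rewrite setUS ?subsetUr.
  have arith (r r' h m : nat) (ie : int) : (r <= r')%N -> (h <= m)%N ->
    (h%:Z = ie - 1)%R -> (r'%:Z <= ie)%R -> (r <= m + 1)%N.
    by clear; lia.
  exact: arith sub (rk_card _) rkH (rk_le_IE coverH indT).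
(* The 1 saved in [boundG] cancels the 1 lost in [boundH], and the independent set [K] in the
   intersection absorbs one of the two terms [#|K|]. *)
have boundJ : (rk (edges GsH :|: K) <= rk (edges GsH))%N.
  have -> : edges GsH :|: K = (edges Gs :|: K) :|: (EH :|: K).
    by rewrite edgesJ setUACA setUid.
  have subK : (#|K| <= rk ((edges Gs :|: K) :&: (EH :|: K)))%N.
    by rewrite -(rk_indep indK); apply: rkS; rewrite subsetI !subsetUr.
  have cardJ : rk (edges GsH) = (#|edges G| + #|edges H|)%N.
    rewrite (rk_indep indJ) edgesJ cardsU disjoint_setI0 // cards0 subn0.
    by rewrite (card_split_edges splitG) card_perm_pairs.
  have arith (u i r1 r2 k g h j : nat) : (u + i <= r1 + r2)%N -> (k <= i)%N ->
    (r1 < g + k)%N -> (r2 <= h + 1)%N -> j = (g + h)%N -> (u <= j)%N.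
    by clear; lia.
  exact: arith (rk_submodular _ _) subK boundG boundH cardJ.
have : ~~ (K \subset edges GsH).
  apply/negP => KJ; have indGsK : indep (edges Gs :|: K).
    by apply: indepS indJ; rewrite subUset EGsJ.
  move: boundG; rewrite (rk_indep indGsK) cardsU disjoint_setI0 // cards0 subn0.
  by rewrite (card_split_edges splitG) ltnn.
case/subsetPn => f fK fJ; exists f.
have [f2 fsv] := key_gluing_pairP fK.
have fV : f \subset verts GsH.
  rewrite vertsJ; apply: subset_trans (subsetUl _ _).
  exact: subset_trans svGs.
apply: circuit_implied => //; first by rewrite /nonedge f2 fV.
rewrite /indep neq_ltn cardsU1 fJ add1n ltnS; apply/orP; left.
apply: leq_trans (rkS _) _; last first.
  by apply: leq_trans boundJ _; apply: rk_card.
by rewrite setUC setUS // sub1set.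
Qed.
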